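(* Let $\lambda$, $\mathsf a=(\mathsf a_{\ell})_{\ell\ge0}$, $\mathsf b=(\mathsf b_{\ell,\ell'})_{\ell,\ell'\ge0}$, $\mathsf c=(\mathsf c_{\ell,\ell'})_{\ell,\ell'\ge0}$, $\mathsf d=(\mathsf d_{\ell,\ell'})_{\ell,\ell'\ge0}$, $\mathsf e=(\mathsf e_\ell)_{\ell\ge0}$ be indeterminates, and for $n\ge0$ define $$\begin{aligned}\widehat Q_n(\mathsf a,\mathsf b,\mathsf c,\mathsf d,\mathsf e,\lambda)=\sum_{\sigma\in\mathfrak S_n}\lambda^{\mathrm{cyc}(\sigma)}\;&\prod_{i\in\mathrm{cval}}\mathsf a_{\mathrm{ucross}(i,\sigma)+\mathrm{unest}(i,\sigma)}\prod_{i\in\mathrm{cpeak}}\mathsf b_{\mathrm{lcross}(i,\sigma),\,\mathrm{lnest}(i,\sigma)}\prod_{i\in\mathrm{cdfall}}\mathsf c_{\mathrm{lcross}(i,\sigma),\,\mathrm{lnest}(i,\sigma)}\\&\times\prod_{i\in\mathrm{cdrise}}\mathsf d_{\mathrm{ucross}(i,\sigma)+\mathrm{unest}(i,\sigma),\;\mathrm{unest}(\sigma^{-1}(i),\sigma)}\prod_{i\in\mathrm{fix}}\mathsf e_{\mathrm{lev}(i,\sigma)}.\end{aligned}$$ Specialize these polynomials to $\mathsf e=\mathsf a$ (i.e. $\mathsf e_\ell=\mathsf a_\ell$ for all $\ell\ge0$), $\mathsf c=\mathsf b$, and $\mathsf d_{n-1,\ell}=\mathsf e_n=\mathsf a_n$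 for all $n\ge1$ and all $\ell\ge0$. Then $$\sum_{n=0}^\infty \widehat Q_n(\mathsf a,\mathsf b,\mathsf b,\mathsf d,\mathsf a,\lambda)\Big|_{\mathsf d_{n-1,\ell}=\mathsf a_n\ \forall \ell}\;t^n=\cfrac{1}{1-\cfrac{\alpha_1t}{1-\cfrac{\alpha_2t}{1-\cfrac{\alpha_3t}{1-\cdots}}}}$$ with coefficients, for $k\ge1$, $$\alpha_{2k-1}=(\lambda+k-1)\,\mathsf a_{k-1},\qquad \alpha_{2k}=\mathsf b^\star_{k-1},\qquad\text{where } \mathsf b^\star_{k-1}=\sum_{\ell=0}^{k-1}\mathsf b_{\ell,k-1-\ell}.$$
   Context: $\mathfrak S_n$ is the set of permutations of $[n]=\{1,\dots,n\}$. Continued fractions are identities of formal power series in $t$. For $\sigma\in\mathfrak S_n$, $\mathrm{cyc}(\sigma)$ is the number of cycles (including fixed points). An index $i\in[n]$ is a cycle peak (cpeak) if $\sigma^{-1}(i)<i>\sigma(i)$; a cycle valley (cval) if $\sigma^{-1}(i)>i<\sigma(i)$; a cycle double rise (cdrise) if $\sigma^{-1}(i)<i<\sigma(i)$; a cycle double fall (cdfall) if $\sigma^{-1}(i)>i>\sigma(i)$; a fixed point (fix) if $\sigma(i)=i$. Products over $i\in\mathrm{cval}$ etc. run over the indices of $\sigma$ of that type. Index-refined statistics (quadruplets and triplets in $[n]$): $\mathrm{ucross}(j,\sigma)=\#\{i<j<k<l:\ k=\sigma(i),\ l=\sigma(j)\}$, $\mathrm{unest}(j,\sigma)=\#\{i<j<k<l:\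 k=\sigma(j),\ l=\sigma(i)\}$, $\mathrm{lcross}(k,\sigma)=\#\{i<j<k<l:\ i=\sigma(k),\ j=\sigma(l)\}$, $\mathrm{lnest}(k,\sigma)=\#\{i<j<k<l:\ i=\sigma(l),\ j=\sigma(k)\}$ (in the first two the index $j$ is fixed and one counts triples $(i,k,l)$; in the last two $k$ is fixed and one counts triples $(i,j,l)$). For a fixed point $j$, $\mathrm{lev}(j,\sigma)=\#\{i<j:\sigma(i)>j\}=\#\{l>j:\sigma(l)<j\}$. *)

(* Defs.v *)
From HB Require Import structures.
From mathcomp Require Import all_boot all_order all_fingroup all_algebra.

Set Implicit Arguments.
Unset Strict Implicit.
Unset Printing Implicit Defensive.

Import GRing.Theory.
Local Open Scope ring_scope.

(* [n] is encoded as 'I_n = {0,...,n-1}. All the statistics below depend only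
   on the relative order of the indices and values, so this shift by one is
   harmless. *)
Section PermutationStatistics.
Variables (n : nat) (s : 'S_n).
Implicit Types i j k l : 'I_n.

Definition sinv : 'S_n := (s^-1)%g.

Definition cyc : nat := #|porbits s|.

Definition cpeak i : bool := (sinv i < i)%N && (s i < i)%N.
Definition cval i : bool := (i < sinv i)%N && (i < s i)%N.
Definition cdrise i : bool := (sinv i < i)%N && (i < s i)%N.
Definition cdfall i : bool := (i < sinv i)%N && (s i < i)%N.
Definition fixpt i : bool := s i == i.

Definition ucross j : nat :=
  #|[set x : 'I_n * 'I_n * 'I_n | let: (i, k, l) := x in
      [&& (i < j)%N, (j < k)%N, (k < l)%N, k == s i & l == s j]]|.

Definition unest j : nat :=
  #|[set x : 'I_n * 'I_n * 'I_n | let: (i, k, l) := x in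
      [&& (i < j)%N, (j < k)%N, (k < l)%N, k == s j & l == s i]]|.

Definition lcross k : nat :=
  #|[set x : 'I_n * 'I_n * 'I_n | let: (i, j, l) := x in
      [&& (i < j)%N, (j < k)%N, (k < l)%N, i == s k & j == s l]]|.

Definition lnest k : nat :=
  #|[set x : 'I_n * 'I_n * 'I_n | let: (i, j, l) := x in
      [&& (i < j)%N, (j < k)%N, (k < l)%N, i == s l & j == s k]]|.

(* Only meaningful (and only used) at fixed points. *)
Definition lev j : nat := #|[set i : 'I_n | (i < j)%N && (j < s i)%N]|.

End PermutationStatistics.

Definition Qhat (R : comNzRingType) (a : nat -> R) (b c d : nat -> nat -> R)
    (e : nat -> R) (lambda : R) (n : nat) : R :=
  \sum_(s : 'S_n)
    lambda ^+ cyc s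
    * (\prod_(i < n | cval s i) a (ucross s i + unest s i)%N)
    * (\prod_(i < n | cpeak s i) b (lcross s i) (lnest s i))
    * (\prod_(i < n | cdfall s i) c (lcross s i) (lnest s i))
    * (\prod_(i < n | cdrise s i)
         d (ucross s i + unest s i)%N (unest s (sinv s i)))
    * (\prod_(i < n | fixpt s i) e (lev s i)).

(* Formal power series in t, given by their sequences of coefficients. *)
Section FormalPowerSeries.
Variable R : comNzRingType.

Definition fps : Type := nat -> R.
Implicit Types f g : fps.

Definition fps_one : fps := fun n => (n == 0%N)%:R.

Definition fps_sub f g : fps := fun n => f n - g n.

Definition fps_mul f g : fps := fun n => \sum_(i < n.+1) f i * g (n - i)%N.

(* The monomial x t. *)
Definition fps_monom1 (x : R) : fps := fun n => if n == 1%N then x else 0.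

Definition fps_exp f (k : nat) : fps := iter k (fps_mul f) fps_one.

(* Inverse of a power series with constant term 1: 1/f = sum_k (1 - f)^k, where
   only the terms k <= n contribute to the coefficient of t^n
   (see [fps_mulV]). *)
Definition fps_inv f : fps :=
  fun n => \sum_(k < n.+1) fps_exp (fps_sub fps_one f) k n.

Lemma fps_exp_small g k n : g 0%N = 0 -> (n < k)%N -> fps_exp g k n = 0.
Proof.
move=> g0; elim: k n => [|k IHk] n //; rewrite ltnS => le_nk.
rewrite /fps_exp iterS /fps_mul big1 // => -[[|i] lt_in] _ /=.
  by rewrite g0 mul0r.
rewrite [iter _ _ _ _]IHk ?mulr0 //.
by apply: leq_trans le_nk; rewrite ltn_subrL; case: n lt_in.
Qed.

Lemma fps_mulV f : f 0%N = 1 -> fps_mul f (fps_inv f) =1 fps_one.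
Proof.
move=> f0 n; set g := fps_sub fps_one f.
have g0 : g 0%N = 0 by rewrite /g /fps_sub f0 subrr.
have fE i : f i = fps_one i - g i by rewrite /g /fps_sub opprB addrC subrK.
have invE m : (m <= n)%N -> fps_inv f m = \sum_(k < n.+1) fps_exp g k m.
  move=> le_mn; rewrite /fps_inv (big_ord_widen n.+1 (fps_exp g ^~ m)) //.
  rewrite [RHS](bigID (fun k : 'I__ => (k < m.+1)%N)) /= [X in _ = _ + X]big1.
    by rewrite addr0.
  by move=> k; rewrite -leqNgt => lt_mk; rewrite fps_exp_small.
rewrite /fps_mul.
under eq_bigr => i _ do rewrite fE mulrBl invE ?leq_subr //.
rewrite sumrB big_ord_recl /= [X in _ + X - _]big1 => [|i _]; last first.
  by rewrite /fps_one mul0r.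
rewrite addr0 mul1r subn0.
have -> : \sum_(i < n.+1) g i * (\sum_(k < n.+1) fps_exp g k (n - i)%N)
        = \sum_(k < n.+1) fps_exp g k.+1 n.
  under eq_bigr => i _ do rewrite mulr_sumr.
  by rewrite exchange_big; apply: eq_bigr.
rewrite big_ord_recl [X in _ - X]big_ord_recr /=.
have -> : fps_mul g (fps_exp g n) n = 0 by apply: (fps_exp_small g0 (ltnSn n)).
by rewrite addr0 addrK.
Qed.

(* Convergence for the t-adic topology: each coefficient is eventually
   constant, with the prescribed value. *)
Definition fps_cvg (F : nat -> fps) (f : fps) : Prop :=
  forall n, exists M, forall m, (M <= m)%N -> F m n = f n.

(* The convergent with the m coefficients alpha_j, ..., alpha_(j+m-1):
   1/(1 - alpha_j t/(1 - ... /(1 - alpha_(j+m-1) t))). *)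
Fixpoint Sfrac_convergent (alpha : nat -> R) (j m : nat) : fps :=
  if m is m'.+1 then
    fps_inv (fps_sub fps_one
      (fps_mul (fps_monom1 (alpha j)) (Sfrac_convergent alpha j.+1 m')))
  else fps_one.

(* f = 1/(1 - alpha_1 t/(1 - alpha_2 t/(1 - ...))); alpha 0 is not used. *)
Definition is_Sfrac (alpha : nat -> R) (f : fps) : Prop :=
  fps_cvg (Sfrac_convergent alpha 1) f.

End FormalPowerSeries.

Definition bstar (R : comNzRingType) (b : nat -> nat -> R) (m : nat) : R :=
  \sum_(l < m.+1) b l (m - l)%N.

(* Main.v *)
Require Import Defs.
From HB Require Import structures.
From mathcomp Require Import all_boot all_order all_fingroup all_algebra.

Set Implicit Arguments.
Unset Strict Implicit.
Unset Printing Implicit Defensive.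

Import GRing.Theory.
Local Open Scope ring_scope.

(** Once [d m l = a m.+1], the five products in [Qhat] merge into one: an index
[j] with [j <= s j] weighs [a r], where [r] counts the [l >= j] with [s l < j],
and an index with [s j < j] weighs [b] at two similar counts. All these
counts read [s] only on the indices [l >= j] ([Qhat_weight]).

The permutation is therefore read from left to right, and what has been read is
contracted. After the indices below [m], every cycle lying entirely below [m]
has been removed, and every maximal path inside [0, m) has been shrunk to one
vertex. Instead of moving to smaller symmetric groups, the contracted
permutations stay in ['S_n]: [linked m P] collects those that fix each [x < m]
outside [P] (the dead vertices) and send each vertex of [P] to [m] or above.
Contraction is multiplication by a transposition, which changes the values
of the permutation at indices [<= m] only, hence keeps the weights of the
later indices, and changes the number of cycles by one.

Reading index [i] takes two half-steps. Let [h = #|P|].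
- Where does [i] go? Either [i <= s i], with weight [a h], or [s i = v]
  for some [v] in [P], which is then absorbed into [i]. If [l] elements of [P]
  are above [v], the weight is [b l (h - 1 - l)], and summing over [v] gives
  [bstar b (h - 1)] ([sweep_index]).
- What is sent to [i]? If it is a later index, then [i] joins [P].
  If it is [i] itself, a cycle is closed, with factor [lambda]. If it is one of
  the [h] elements of [P], then [i] is absorbed into it. The last two cases
  give the factor [lambda + h] ([half_sweep_value]).

So the weighted sum over [linked m P] depends only on [#|P|] and [n - m], and up
to the factor [a 0 * ... * a (h - 1)] it satisfies the recurrence of
suffixes of Dyck paths from height [2h] whose descents from height [k] weigh
[alpha k] ([sweep_dyck]). For [P] empty and [m = 0] this equates [Qhat] with
the weighted count of Dyck paths of length [2n].

That the latter has the S-fraction as its generating function is Flajolet's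
theorem, obtained here by cutting a path from height [k] to [0] at its first
visits to the heights [k - 1, ..., 0]: the paths from height [k] to [0] have
generating function [alpha_k ... alpha_1 S_(k+1) ... S_1], where [S_j] is
the fraction starting at [alpha_j] ([dyck_descent]). *)

(** * The product of formal power series *)

Section FpsAlgebra.
Variable R : comNzRingType.
Implicit Types f g h : fps R.

Lemma eq_fps_mul f f' g g' : f =1 f' -> g =1 g' -> fps_mul f g =1 fps_mul f' g'.
Proof. by move=> ff gg n; apply: eq_bigr => i _; rewrite ff gg. Qed.

(** Ring identities for series are inherited from polynomials, since a
coefficient of a product involves finitely many coefficients of the factors. *)
Lemma fps_mul_poly N f g n : (n < N)%N ->
  fps_mul f g n = ((\poly_(i < N) f i) * (\poly_(i < N) g i))`_n.
Proof.
move=> lt_nN; rewrite coefM; apply: eq_bigr => i _.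
rewrite !coef_poly (leq_ltn_trans (leq_subr _ _) lt_nN).
by rewrite (leq_ltn_trans _ lt_nN) // -ltnS.
Qed.

Lemma fps_mulC f g : fps_mul f g =1 fps_mul g f.
Proof. by move=> n; rewrite !(fps_mul_poly _ _ (ltnSn n)) mulrC. Qed.

Lemma fps_mulA f g h : fps_mul f (fps_mul g h) =1 fps_mul (fps_mul f g) h.
Proof.
move=> n; pose tr u := \poly_(i < n.+1) (u : fps R) i.
have trE u i : (i < n.+1)%N -> u i = (tr u)`_i.
  by move=> lt_i; rewrite coef_poly lt_i.
transitivity ((tr f * (tr g * tr h))`_n).
  rewrite coefM; apply: eq_bigr => i _.
  by rewrite -trE // (fps_mul_poly _ _ (N := n.+1)) // ltnS leq_subr.
rewrite mulrA coefM; apply: eq_bigr => i _.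
by rewrite -trE ?ltnS ?leq_subr // (fps_mul_poly _ _ (N := n.+1)).
Qed.

Lemma fps_mul1 f : fps_mul f (fps_one R) =1 f.
Proof.
move=> n; rewrite fps_mulC /fps_mul big_ord_recl big1 /= => [|i _].
  by rewrite /fps_one mul1r addr0 subn0.
by rewrite /fps_one mul0r.
Qed.

Lemma fps_mulDl f g h : fps_mul (fun n => f n + g n) h =1
  (fun n => fps_mul f h n + fps_mul g h n).
Proof.
by move=> n; rewrite -big_split; apply: eq_bigr => i _; rewrite mulrDl.
Qed.

Lemma fps_mul_monom1 x f n :
  fps_mul (fps_monom1 x) f n = if n is n'.+1 then x * f n' else 0.
Proof.
rewrite /fps_mul big_ord_recl mul0r add0r.
case: n => [|n]; first by rewrite big_ord0.
rewrite big_ord_recl /= big1 => [|i _]; last by rewrite mul0r.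
by rewrite addr0 /fps_monom1 /= subSS subn0.
Qed.

End FpsAlgebra.

(** * Stieltjes fractions and Dyck paths *)

Section SfracDyck.
Variables (R : comNzRingType) (alpha : nat -> R).

Lemma Sfrac_convergent0 j m : Sfrac_convergent alpha j m 0%N = 1.
Proof. by case: m => [|m] //=; rewrite /fps_inv big_ord1. Qed.

(** The defining equation [S = 1/(1 - alpha_j t S')] cleared of its inverse:
[S = 1 + alpha_j t S' S]. *)
Lemma Sfrac_convergentS j m n : Sfrac_convergent alpha j m.+1 n =
  fps_one R n + fps_mul (fps_mul (fps_monom1 (alpha j))
     (Sfrac_convergent alpha j.+1 m)) (Sfrac_convergent alpha j m.+1) n.
Proof.
rewrite [Sfrac_convergent alpha j m.+1]/=.
set g := fps_mul (fps_monom1 _) _; set f := fps_sub _ g.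
have f0 : f 0%N = 1 by rewrite /f /fps_sub /g fps_mul_monom1 subr0.
have := fps_mulDl f g (fps_inv f) n; rewrite (fps_mulV f0) => <-.
rewrite -[LHS]fps_mul1 fps_mulC; apply: eq_fps_mul => // i.
by rewrite /f /fps_sub subrK.
Qed.

(** Nonnegative paths with [L] steps from height [k] to height 0, where a
descent from height [k] weighs [alpha k]. *)
Fixpoint dyck (k L : nat) : R :=
  match L, k with
  | 0, 0 => 1
  | 0, _.+1 => 0
  | L'.+1, 0 => dyck 1 L'
  | L'.+1, k'.+1 => dyck k.+1 L' + alpha k * dyck k' L'
  end.

Lemma dyck_short k L : (L < k)%N -> dyck k L = 0.
Proof.
elim: L k => [|L IHL] [|k] //=; rewrite ltnS => lt_Lk.
by rewrite !IHL ?mulr0 ?addr0 // ltnW // ltnW.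
Qed.

(** The product of [alpha_j S_j] for [1 <= j <= k], with [S_j] truncated to the
convergent with coefficients [alpha_j, ..., alpha_m]. *)
Fixpoint descent_head (m k : nat) : fps R :=
  if k is k'.+1 then fun n =>
    alpha k * fps_mul (descent_head m k') (Sfrac_convergent alpha k (m - k')) n
  else fps_one R.

Definition descent m k : fps R :=
  fps_mul (descent_head m k) (Sfrac_convergent alpha k.+1 (m - k)).

Lemma descent0 m k : descent m k 0%N = descent_head m k 0%N.
Proof. by rewrite /descent /fps_mul big_ord1 Sfrac_convergent0 mulr1. Qed.

(** Substituting [S_(k+1) = 1 + alpha_(k+1) t S_(k+2) S_(k+1)] in the last
factor of [descent m k]. For [k = m] the last convergent is empty and this step
fails, which limits the coefficients that [m] levels determine. *)
Lemma descentS m k n : (k < m)%N ->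
  descent m k n.+1 = descent_head m k n.+1 + descent m k.+1 n.
Proof.
move=> lt_km; rewrite /descent [descent_head m k.+1]/=.
set E := descent_head m k; rewrite -(subnSK lt_km).
set S := Sfrac_convergent alpha k.+1 _; set S' := Sfrac_convergent alpha k.+2 _.
have SE : S =1 fun i => fps_one R i +
    fps_mul (fps_mul (fps_monom1 (alpha k.+1)) S') S i.
  by move=> i; apply: Sfrac_convergentS.
rewrite (eq_fps_mul (frefl E) SE) fps_mulC fps_mulDl fps_mulC fps_mul1.
congr (_ + _); set X := fps_monom1 _.
have -> : fps_mul (fps_mul (fps_mul X S') S) E n.+1 =
          fps_mul X (fps_mul (fps_mul E S) S') n.+1.
  rewrite -fps_mulA -fps_mulA; apply: eq_fps_mul => // i.
  rewrite [RHS]fps_mulC; apply: eq_fps_mul => // l.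
  exact: fps_mulC.
rewrite fps_mul_monom1 /fps_mul mulr_sumr; apply: eq_bigr => i _.
by rewrite mulrA.
Qed.

(** Both sides satisfy the same recurrence on the first step of the path; a
path with [k + n.*2] steps from height [k] stays at heights at most [k + n], so
it uses only coefficients kept by the truncation. *)
Lemma dyck_descent m k n : (k + n <= m)%N -> dyck k (k + n.*2) = descent m k n.
Proof.
move: {2}(k + n.*2)%N (erefl (k + n.*2)%N) => L.
elim: L k n => [|L IHL] [|k] [|n] //=.
- by rewrite descent0.
- rewrite add0n doubleS => -[eqL] lt_nm.
  have -> := descentS n (leq_ltn_trans (leq0n n) lt_nm).
  rewrite /= /fps_one add0r -IHL ?add1n //.
- rewrite double0 !addn0 => -[eqL] lt_km.
  rewrite /= dyck_short // add0r descent0 [RHS]/=.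
  by rewrite -[fps_mul _ _ _](IHL k 0%N) ?double0 ?addn0 // ltnW.
rewrite addSn => -[eqL] le_m.
have lt_km : (k.+1 < m)%N.
  by apply: leq_trans le_m; rewrite addnS !ltnS leq_addr.
have -> := descentS n lt_km.
have le_m' : (k + n.+1 <= m)%N by rewrite ltnW // -addSn.
have eqL' : (k.+2 + n.*2 = k + n.+1.*2)%N by rewrite doubleS !addnS.
rewrite /= addrC -[fps_mul _ _ _](IHL k n.+1) // -eqL' IHL // ?eqL' //.
by rewrite addSn -addnS.
Qed.


Lemma is_Sfrac_dyck (f : fps R) :
  (forall n, f n = dyck 0 n.*2) -> is_Sfrac alpha f.
Proof.
move=> fE n; exists n => m le_nm; rewrite fE.
rewrite -[n.*2]add0n (@dyck_descent m) // /descent subn0.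
by rewrite fps_mulC fps_mul1.
Qed.

End SfracDyck.

(** * Weights that depend on a suffix of the permutation *)

Section LocalWeight.
Variables (n : nat) (s : 'S_n).
Implicit Types i j k l : 'I_n.

Definition backlog j : nat := #|[set l : 'I_n | (j <= l)%N && (s l < j)%N]|.

(** A permutation crosses the cut before [j] equally often both ways. *)
Lemma card_weak_overarcs j :
  #|[set i : 'I_n | (i < j)%N && (j <= s i)%N]| = backlog j.
Proof.
pose A := [set i : 'I_n | (i < j)%N]; pose B := s @^-1: A.
have AB : #|A :\: B| = #|B :\: A|.
  apply/eqP; rewrite -(eqn_add2l #|A :&: B|) cardsID (setIC A) cardsID.
  by rewrite card_preimset //; apply: perm_inj.
transitivity #|A :\: B|; last rewrite AB; apply: eq_card => l.
  by rewrite !inE -leqNgt andbC.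
by rewrite !inE -leqNgt.
Qed.

(** No arc ends at [j] from the left, as for cycle valleys and fixed points. *)
Lemma card_overarcs j : (j <= sinv s j)%N ->
  #|[set i : 'I_n | (i < j)%N && (j < s i)%N]| = backlog j.
Proof.
move=> le_j; rewrite -card_weak_overarcs; apply: eq_card => i; rewrite !inE.
case: ltnP => //= lt_ij; rewrite ltn_neqAle andb_idl // => _.
apply: contraTneq lt_ij => /val_inj eq_j.
by rewrite -leqNgt -[i](permK s) -eq_j.
Qed.

(** For a cycle double rise, the arc ending at [j] is the one that the strict
count misses; this is the shift by one in [d m l = a m.+1]. *)
Lemma card_overarcs_rise j : (sinv s j < j)%N ->
  (#|[set i : 'I_n | (i < j)%N && (j < s i)%N]|).+1 = backlog j.
Proof.
move=> lt_j; rewrite -card_weak_overarcs [RHS](cardsD1 (sinv s j)).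
rewrite !inE lt_j permKV leqnn add1n; congr _.+1; apply: eq_card => i.
rewrite !inE; case: (ltnP i j) => [lt_ij|]; last by rewrite !andbF.
rewrite /= ltn_neqAle; congr (_ && _); congr (~~ _).
rewrite -(inj_eq (@perm_inj _ s)) permKV eq_sym.
exact: (inj_eq val_inj).
Qed.

(** The arcs above [j] end either before or after [s j]. *)
Lemma ucross_unest j : (j < s j)%N ->
  (ucross s j + unest s j)%N = #|[set i : 'I_n | (i < j)%N && (j < s i)%N]|.
Proof.
move=> lt_j; set A := [set i | _].
pose B := [set i : 'I_n | (s i < s j)%N].
rewrite -(cardsID B A); congr (_ + _)%N.
  have inj : injective (fun i => (i, s i, s j)) by move=> i i' [].
  rewrite -(card_imset _ inj) /ucross; apply: eq_card => -[[i k] l].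
  rewrite !inE; apply/idP/imsetP => [/and5P[lt1 lt2 lt3 /eqP ek /eqP el]|].
    by subst; exists i; rewrite ?inE ?lt1 ?lt2.
  by case=> i'; rewrite !inE => /andP[/andP[lt1 lt2] lt3] [-> -> ->];
    rewrite lt1 lt2 lt3 !eqxx.
have inj : injective (fun i => (i, s j, s i)) by move=> i i' [].
rewrite -(card_imset _ inj) /unest; apply: eq_card => -[[i k] l].
rewrite !inE; apply/idP/imsetP => [/and5P[lt1 lt2 lt3 /eqP ek /eqP el]|].
  subst; exists i; rewrite ?inE ?lt1 //= -leqNgt ltnW //=.
  exact: ltn_trans lt3.
case=> i'; rewrite !inE -leqNgt => /andP[le3 /andP[lt1 lt2]] [-> -> ->].
rewrite !eqxx lt1 lt_j ltn_neqAle le3 !andbT /=.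
apply: contraTneq lt1 => /val_inj/perm_inj <-.
by rewrite ltnn.
Qed.

Lemma lcrossE k :
  lcross s k = #|[set l : 'I_n | [&& (k < l)%N, (s k < s l)%N & (s l < k)%N]]|.
Proof.
have inj : injective (fun l => (s k, s l, l)) by move=> l l' [].
rewrite -(card_imset _ inj) /lcross; apply: eq_card => -[[i j] l].
rewrite !inE; apply/idP/imsetP => [/and5P[lt1 lt2 lt3 /eqP ei /eqP ej]|].
  by subst; exists l; rewrite ?inE ?lt1 ?lt2 ?lt3.
by case=> l'; rewrite !inE => /and3P[lt1 lt2 lt3] [-> -> ->];
    rewrite lt1 lt2 lt3 !eqxx.
Qed.

Lemma lnestE k : (s k < k)%N ->
  lnest s k = #|[set l : 'I_n | (k < l)%N && (s l < s k)%N]|.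
Proof.
move=> lt_k.
have inj : injective (fun l => (s l, s k, l)) by move=> l l' [].
rewrite -(card_imset _ inj) /lnest; apply: eq_card => -[[i j] l].
rewrite !inE; apply/idP/imsetP => [/and5P[lt1 lt2 lt3 /eqP ei /eqP ej]|].
  by subst; exists l; rewrite ?inE ?lt1 ?lt2 ?lt3.
by case=> l'; rewrite !inE => /andP[lt1 lt2] [-> -> ->];
  rewrite lt1 lt2 lt_k !eqxx.
Qed.

End LocalWeight.

(** The form taken in all five classes by the factor of index [j] when
[c = b], [e = a] and [d m l = a m.+1], chosen so that it is read off the restriction of [s] to the indices [l >= j]. *)
Definition weight (R : comNzRingType) (a : nat -> R) (b : nat -> nat -> R)
    (n : nat) (s : 'S_n) (j : 'I_n) : R :=
  if (j <= s j)%N then a (backlog s j)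
  else b #|[set l : 'I_n | [&& (j < l)%N, (s j < s l)%N & (s l < j)%N]]|
         #|[set l : 'I_n | (j < l)%N && (s l < s j)%N]|.

Lemma Qhat_weight (R : comNzRingType) (lambda : R) (a : nat -> R)
    (b d : nat -> nat -> R) (dE : forall m l, d m l = a m.+1) (n : nat) :
  Qhat a b b d a lambda n =
  \sum_(s : 'S_n) lambda ^+ #|porbits s| * \prod_j weight a b s j.
Proof.
apply: eq_bigr => s _; rewrite -!mulrA; congr (_ * _).
rewrite (big_mkcond (cval s)) (big_mkcond (cpeak s)) (big_mkcond (cdfall s)).
rewrite (big_mkcond (cdrise s)) (big_mkcond (fixpt s)) -!big_split /=.
apply: eq_bigr => j _; rewrite /weight.
have fixV : sinv s j = j -> s j = j by move=> e; rewrite -{1}e permKV.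
rewrite /cval /cpeak /cdfall /cdrise /fixpt.
case: (ltngtP j (s j)) => [lt_j|gt_j|/val_inj eq_j].
- have -> : (s j == j) = false by apply: contraTF lt_j => /eqP->; rewrite ltnn.
  rewrite !andbT !andbF ucross_unest // !mul1r !mulr1.
  case: (ltngtP j (sinv s j)) => [lt_jV|gt_jV|/val_inj eq_jV].
  + by rewrite mulr1 card_overarcs // ltnW.
  + by rewrite mul1r dE card_overarcs_rise.
  by move: lt_j; rewrite (fixV (esym eq_jV)) ltnn.
- have -> : (s j == j) = false by apply: contraTF gt_j => /eqP->; rewrite ltnn.
  rewrite !andbT !andbF !mul1r !mulr1 -lcrossE -lnestE //.
  case: (ltngtP j (sinv s j)) => [lt_jV|gt_jV|/val_inj eq_jV].
  + by rewrite mul1r.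
  + by rewrite mulr1.
  by move: gt_j; rewrite (fixV (esym eq_jV)) ltnn.
rewrite -eq_j eqxx !andbF !mul1r.
have jV : sinv s j = j by rewrite {1}eq_j permK.
by rewrite -(@card_overarcs _ s j) ?jV.
Qed.

(** * Counting lemmas for ranks and cycles *)

Section RankSum.
Variables (R : comNzRingType) (b : nat -> nat -> R) (n : nat).

(** If [v] has [l] elements of [P] above it, it has [#|P| - 1 - l] below, and
each [l < #|P|] occurs once. *)
Lemma sum_ranks_bstar (P : {set 'I_n}) :
  \sum_(v in P) b #|[set p in P | (v < p)%N]| #|[set p in P | (p < v)%N]| =
  if #|P| is h.+1 then bstar b h else 0.
Proof.
pose up (v : 'I_n) := #|[set p in P | (v < p)%N]|.
case def_h: #|P| => [|h].
  by apply: big_pred0 => v; apply: (card0_eq def_h).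
have up_lt v : v \in P -> (up v < h.+1)%N.
  move=> Pv; rewrite -def_h; apply: proper_card; apply/properP; split.
    by apply/subsetP=> p; rewrite inE => /andP[].
  by exists v; rewrite // inE ltnn andbF.
have downE v : v \in P -> #|[set p in P | (p < v)%N]| = (h - up v)%N.
  move=> Pv; have := cardsD1 v P; rewrite Pv def_h add1n => -[->].
  rewrite -(cardsID [set p : 'I_n | (v < p)%N] (P :\ v)) (_ : #|_ :&: _| = up v).
    rewrite addKn; apply: eq_card => p; rewrite !inE -val_eqE /=.
    by case: ltngtP; rewrite ?andbT ?andbF.
  apply: eq_card => p; rewrite !inE -val_eqE /=.
  by case: ltngtP; rewrite ?andbT ?andbF.
(* [inord] is only used on [v] in [P], where [up v < h.+1]. *)
pose rank v : 'I_h.+1 := inord (up v).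
have rankE v : v \in P -> rank v = up v :> nat by move=> Pv; rewrite inordK ?up_lt.
have up_mono v w : v \in P -> w \in P -> (v < w)%N -> (up w < up v)%N.
  move=> Pv Pw lt_vw; apply: proper_card; apply/properP; split.
    apply/subsetP=> p; rewrite !inE => /andP[-> lt_wp].
    exact: ltn_trans lt_wp.
  by exists w; rewrite !inE Pw ?ltnn.
have rank_inj : {in P &, injective rank}.
  move=> v w Pv Pw /(congr1 val) /=; rewrite !rankE // => eq_up.
  apply/val_inj; case: (ltngtP v w) => // lt_vw.
    by have := up_mono v w Pv Pw lt_vw; rewrite eq_up ltnn.
  by have := up_mono w v Pw Pv lt_vw; rewrite eq_up ltnn.
have rankT : rank @: P = setT.
  by apply/eqP; rewrite eqEcard subsetT cardsT card_ord card_in_imset // def_h ltnSn.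
transitivity (\sum_(l in rank @: P) b l (h - l)%N); last first.
  by rewrite rankT; apply: eq_bigl => l; rewrite inE.
rewrite big_imset //=.
by apply: eq_bigr => v Pv; rewrite rankE // downE.
Qed.

End RankSum.

(** Inserting a fixed point [x] of [s] into the cycle of [y] merges two
cycles. *)
Lemma card_porbits_tperm_fix (T : finType) (s : {perm T}) x y :
  s x = x -> x != y -> (#|porbits (tperm x y * s)%g|).+1 = #|porbits s|.
Proof.
move=> sx neq_xy; have := porbits_mul_tperm s x y; rewrite neq_xy /=.
have -> : x \notin porbit s y.
  rewrite porbit_sym; apply: contra neq_xy => /porbitP[i ->].
  by rewrite permX; elim: i => //= i /eqP <-; rewrite sx.
by rewrite /= addn2 addn1 => -[].
Qed.

Lemma card_fix_porbits (T : finType) (s : {perm T}) (A : {set T}) :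
  {in A, forall x, s x = x} -> (#|A| <= #|porbits s|)%N.
Proof.
move=> fixA; rewrite -(card_in_imset (f := porbit s) (D := A)).
  by apply/subset_leq_card/subsetP => _ /imsetP[x _ ->]; apply: imset_f.
move=> x y Ax Ay eq_xy; have := porbit_id s y; rewrite -eq_xy => /porbitP[i ->].
by rewrite permX; elim: i => //= i <-; rewrite fixA.
Qed.

(** * Contracted permutations *)

Section Linked.
Variable n : nat.
Implicit Types (i j v p x : 'I_n) (P : {set 'I_n}) (s t : 'S_n).

(** The permutations of the indices from [m] on together with the vertices of
[P], each standing for a path already read. The other indices below [m] are dead:
they are kept as fixed points so that the ambient group does not change. *)
Definition linked (m : nat) P s : bool :=
  [forall x : 'I_n, (x < m)%N ==> (if x \in P then m <= s x else s x == x)%N].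

Lemma linkedP m P s :
  reflect (forall x : 'I_n, (x < m)%N ->
             if x \in P then is_true (m <= s x)%N else s x = x) (linked m P s).
Proof.
apply: (iffP 'forall_implyP) => H x /H; case: ifP => // _; first by move/eqP.
by move->.
Qed.

Definition below (m : nat) P : Prop := {in P, forall x, (x < m)%N}.

Lemma card_lt_ord m : (m <= n)%N -> #|[set x : 'I_n | (x < m)%N]| = m.
Proof.
move=> le_mn; rewrite -sum1dep_card.
by rewrite -(big_ord_widen n (fun=> 1%N) le_mn) sum_nat_const card_ord muln1.
Qed.

Lemma below_card m P : (m <= n)%N -> below m P -> (#|P| <= m)%N.
Proof.
move=> le_mn ltP; rewrite -[m in (_ <= m)%N](card_lt_ord le_mn).
by apply/subset_leq_card/subsetP => x /ltP; rewrite inE.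
Qed.

(** The arcs crossing the cut [m] downwards are the arcs into [P]. This turns
each count of arcs into a count of elements of [P]. *)
Lemma mem_linked m P s x : below m P -> linked m P s ->
  (s x \in P) = (m <= x)%N && (s x < m)%N.
Proof.
move=> ltP /linkedP linkP; apply/idP/andP => [Psx | [le_x lt_sx]].
  have lt_sx := ltP _ Psx; split=> //; rewrite leqNgt; apply/negP => lt_x.
  have := linkP x lt_x; case: ifP => [_|nPx eq_sx]; first by rewrite leqNgt lt_sx.
  by rewrite eq_sx nPx in Psx.
have := linkP _ lt_sx; case: ifP => // _ /perm_inj eq_sx.
by rewrite eq_sx ltnNge le_x in lt_sx.
Qed.

Lemma backlog_linked i P s : below i P -> linked i P s -> backlog s i = #|P|.
Proof.
move=> ltP linkP; rewrite -(card_preimset P (@perm_inj _ s)).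
by apply: eq_card => l; rewrite !inE (mem_linked _ ltP).
Qed.

Lemma card_linked_above i P s : below i P -> linked i P s ->
  #|[set l : 'I_n | [&& (i < l)%N, (s i < s l)%N & (s l < i)%N]]| =
  #|[set p in P | (s i < p)%N]|.
Proof.
move=> ltP linkP; rewrite -(card_preimset _ (@perm_inj _ s)).
apply: eq_card => l; rewrite !inE (mem_linked _ ltP) //.
rewrite [(i < l)%N]ltn_neqAle; case: (ltnP (s i) (s l)) => [lt_l|].
  rewrite /= andbT -andbA andb_idl // => _.
  by apply: contraTneq lt_l => /val_inj->; rewrite ltnn.
by rewrite /= !andbF.
Qed.

Lemma card_linked_under i P s : below i P -> linked i P s -> (s i < i)%N ->
  #|[set l : 'I_n | (i < l)%N && (s l < s i)%N]| =
  #|[set p in P | (p < s i)%N]|.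
Proof.
move=> ltP linkP lt_si; rewrite -(card_preimset _ (@perm_inj _ s)).
apply: eq_card => l; rewrite !inE (mem_linked _ ltP) // [(i < l)%N]ltn_neqAle.
case: (ltnP (s l) (s i)) => [lt_l|]; last by rewrite !andbF.
rewrite (ltn_trans lt_l) // !andbT andb_idl // => _.
by apply: contraTneq lt_l => /val_inj->; rewrite ltnn.
Qed.

(** Absorbing [v] into [i] when [s i = v]: the contracted permutation [t] sends
[i] to [s v] and makes [v] dead. If moreover [s v = i], then [t] fixes [i], so the
cycle is left to be closed in the other half-step. *)
Lemma linked_removeL i P v t : below i P -> v \in P ->
  linked i P (tperm i v * t)%g && ((tperm i v * t)%g i == v) =
  linked i (P :\ v) t && (i <= t i)%N.
Proof.
move=> ltP Pv; have lt_v := ltP _ Pv.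
have neq x : (x < i)%N -> x != i by apply: contraTneq => ->; rewrite ltnn.
rewrite permM tpermL; apply/andP/andP => -[/linkedP linkP].
  move/eqP=> tv; split; last first.
    by have := linkP v lt_v; rewrite Pv permM tpermR.
  apply/linkedP => x lt_x; have := linkP x lt_x; rewrite permM !inE.
  case: (eqVneq x v) => [-> //|neq_x /=].
  by rewrite tpermD // eq_sym // neq.
move=> le_ti; have tv: t v = v by have := linkP v lt_v; rewrite !inE eqxx.
rewrite tv eqxx; split=> //; apply/linkedP => x lt_x.
have := linkP x lt_x; rewrite permM !inE.
case: (eqVneq x v) => [-> _|neq_x /=]; first by rewrite Pv tpermR.
by rewrite tpermD // eq_sym // neq.
Qed.

(** Absorbing [i] into [p] when [s p = i]: the contracted permutation [t] sends
[p] to [s i] and makes [i] dead. *)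
Lemma linked_removeR i P p t : below i P -> p \in P ->
  [&& linked i P (tperm i p * t)%g, (i <= (tperm i p * t)%g i)%N
    & (tperm i p * t)%g p == i] = linked i.+1 P t.
Proof.
move=> ltP Pp; have lt_p := ltP _ Pp.
have neq x : (x < i)%N -> x != i by apply: contraTneq => ->; rewrite ltnn.
rewrite !permM tpermL tpermR; apply/and3P/idP => [[/linkedP linkP le_tp /eqP ti]|].
  have lt_t x : x != i -> (i <= t x)%N -> (i < t x)%N.
    move=> neq_x le_x; rewrite ltn_neqAle le_x andbT.
    apply: contraNneq neq_x => /val_inj eq_x.
    by rewrite -(inj_eq (@perm_inj _ t)) ti -eq_x.
  apply/linkedP => x; rewrite ltnS leq_eqVlt => /predU1P[/val_inj->|lt_x].
    by rewrite ti; case: ifP => // /ltP; rewrite ltnn.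
  have := linkP x lt_x; rewrite permM.
  case: (eqVneq x p) => [-> _|neq_x]; first by rewrite Pp lt_t ?neq.
  rewrite tpermD 1?eq_sym ?neq //; case: ifP => // _.
  by apply: lt_t; rewrite neq.
move/linkedP=> linkP; have ti: t i = i.
  by have := linkP i (leqnn _); case: ifP => // /ltP; rewrite ltnn.
have lt_tp: (i < t p)%N by have := linkP p (ltnW lt_p); rewrite Pp.
rewrite ti (ltnW lt_tp) eqxx; split=> //; apply/linkedP => x lt_x.
have := linkP x (ltnW lt_x); rewrite permM.
case: (eqVneq x p) => [-> _|neq_x]; first by rewrite Pp tpermR ti.
rewrite tpermD 1?eq_sym ?neq //; case: ifP => // _.
exact: ltnW.
Qed.

(** When [s i = i], the index [i] becomes dead without changing [s]. *)
Lemma linked_fix i P s : below i P ->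
  linked i P s && (s i == i) = linked i.+1 P s.
Proof.
move=> ltP; have nPi : i \notin P by apply/negP => /ltP; rewrite ltnn.
apply/andP/idP => [[/linkedP linkP /eqP si]|/linkedP linkP].
  apply/linkedP => x; rewrite ltnS leq_eqVlt => /predU1P[/val_inj->|lt_x].
    by rewrite (negPf nPi) si.
  have := linkP x lt_x; case: ifP => // _ le_i; rewrite ltn_neqAle le_i andbT.
  apply: contraTneq lt_x => /val_inj; rewrite -{1}si => /perm_inj <-.
  by rewrite ltnn.
have := linkP i (leqnn _); rewrite (negPf nPi) => si; rewrite si eqxx; split=> //.
apply/linkedP => x lt_x; have := linkP x (ltnW lt_x); case: ifP => // _.
exact: ltnW.
Qed.

(** When [i] lies below both its image and its preimage, it becomes a new path
without changing [s]. *)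
Lemma linked_open i P s : below i P ->
  [&& linked i P s, (i < s i)%N & (i < (s^-1)%g i)%N] = linked i.+1 (i |: P) s.
Proof.
move=> ltP; apply/and3P/idP => [[/linkedP linkP lt_si lt_sVi]|/linkedP linkP].
  apply/linkedP => x; rewrite ltnS leq_eqVlt => /predU1P[/val_inj->|lt_x].
    by rewrite !inE eqxx.
  rewrite !inE (_ : (x == i) = false) /=; last first.
    by apply: contraTF lt_x => /eqP->; rewrite ltnn.
  have := linkP x lt_x; case: ifP => // _ le_i; rewrite ltn_neqAle le_i andbT.
  apply: contraTneq lt_sVi => /val_inj ->; rewrite permK -leqNgt.
  exact: leq_trans (ltnW lt_x) le_i.
have lt_si: (i < s i)%N by have := linkP i (leqnn _); rewrite !inE eqxx.
split=> //.
  apply/linkedP => x lt_x; have := linkP x (ltnW lt_x); rewrite !inE.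
  rewrite (_ : (x == i) = false) /=; last first.
    by apply: contraTF lt_x => /eqP->; rewrite ltnn.
  by case: ifP => // _; apply: ltnW.
rewrite ltnNge; apply/negP; rewrite -ltnS => /linkP; rewrite !inE permKV.
case: ifP => [_|]; first by rewrite ltnn.
by move/negbT; rewrite negb_or => /andP[/eqP neq_i _] eq_i; apply: neq_i.
Qed.

End Linked.

(** * Reading a permutation from left to right *)

Section Sweep.
Variables (R : comNzRingType) (lambda : R) (a : nat -> R) (b : nat -> nat -> R).

Lemma eq_weight_suffix n (s t : 'S_n) (j : 'I_n) :
  (forall l : 'I_n, (j <= l)%N -> s l = t l) -> weight a b s j = weight a b t j.
Proof.
move=> eq_st; rewrite /weight eq_st //; congr (if _ then a _ else b _ _).
- by apply: eq_card => l; rewrite !inE; case: (leqP j l) => //= /eq_st->.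
- by apply: eq_card => l; rewrite !inE; case: (ltnP j l) => //= lt_jl;
  rewrite !eq_st ?(ltnW lt_jl).
by apply: eq_card => l; rewrite !inE; case: (ltnP j l) => //= lt_jl;
  rewrite !eq_st ?(ltnW lt_jl).
Qed.

Variable n : nat.
Implicit Types (i j v p x : 'I_n) (P : {set 'I_n}) (s t : 'S_n).

Lemma eq_weight_tperm i x t j : (x <= i)%N -> (i < j)%N ->
  weight a b (tperm i x * t)%g j = weight a b t j.
Proof.
move=> le_xi lt_ij; apply: eq_weight_suffix => l le_jl; rewrite permM.
have lt_il := leq_trans lt_ij le_jl.
by rewrite tpermD //; [move: lt_il | move: (leq_ltn_trans le_xi lt_il)];
   apply: contraTneq => ->; rewrite ltnn.
Qed.

(** The exponent of [lambda] is the number of cycles among the vertices that are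
not dead, as there are [m - #|P|] dead fixed points. *)
Definition sweep (m : nat) P : R :=
  \sum_(s | linked m P s) lambda ^+ (#|porbits s| - (m - #|P|))
    * \prod_(j : 'I_n | (m <= j)%N) weight a b s j.

(** The sum over the permutations with [i <= s i]; the weight of [i] is left
out, being [a #|P|] for all of them. *)
Definition half_sweep i P : R :=
  \sum_(s | linked i P s && (i <= s i)%N)
    lambda ^+ (#|porbits s| - (i - #|P|))
    * \prod_(j : 'I_n | (i < j)%N) weight a b s j.

Lemma prod_suffix i (F : 'I_n -> R) :
  \prod_(j : 'I_n | (i <= j)%N) F j = F i * \prod_(j : 'I_n | (i < j)%N) F j.
Proof.
rewrite (bigD1 i) //=; congr (_ * _); apply: eq_bigl => j.
by rewrite ltn_neqAle andbC eq_sym.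
Qed.

(** Splits according to the image of [i]: weakly above [i], or some [v] in [P],
in which case [v] is absorbed into [i]. *)
Lemma sweep_index i P : below i P ->
  sweep i P = a #|P| * half_sweep i P
    + \sum_(v in P) b #|[set p in P | (v < p)%N]| #|[set p in P | (p < v)%N]|
        * half_sweep i (P :\ v).
Proof.
move=> ltP; rewrite /sweep (bigID (fun s => i <= s i)%N) /=; congr (_ + _).
  rewrite /half_sweep mulr_sumr; apply: eq_bigr => s /andP[linkP le_si].
  by rewrite prod_suffix /weight le_si (backlog_linked ltP) // mulrCA.
rewrite (partition_big (fun s => s i) (mem P)) /= => [|s /andP[linkP]]; last first.
  by rewrite -ltnNge (mem_linked _ ltP linkP) leqnn.
apply: eq_bigr => v Pv; have lt_v := ltP _ Pv.
rewrite /half_sweep mulr_sumr (reindex_inj (mulgI (tperm i v))) /=.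
apply: eq_big => [t|t /andP[/andP[linkP lt_ti] /eqP ti]].
  rewrite -linked_removeL // andbAC andb_idr // => /andP[_ /eqP->].
  by rewrite -ltnNge.
rewrite prod_suffix {1}/weight (negPf lt_ti) (card_linked_above ltP) //.
rewrite (card_linked_under ltP) ?ti // mulrCA; congr (_ * (_ * _)).
  have neq_vi : v != i by apply: contraTneq lt_v => ->; rewrite ltnn.
  have tv : t v = v by rewrite -[RHS]ti permM tpermL.
  rewrite -(card_porbits_tperm_fix tv neq_vi) tpermC.
  have le_Pi : (#|P| <= i)%N by apply: below_card => //; apply: ltnW.
  move: le_Pi; rewrite (cardsD1 v P) Pv add1n => le_Pi.
  by rewrite -(subnSK le_Pi) subSS.
by apply: eq_bigr => j lt_ij; rewrite eq_weight_tperm // ltnW.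
Qed.

(** Splits according to the preimage of [i]: above [i], equal to [i], or some [p]
in [P], in which case [i] is absorbed into [p]. The second case closes a
cycle, whence [lambda], and each [p] in [P] contributes 1. *)
Lemma half_sweep_value i P : below i P ->
  half_sweep i P = sweep i.+1 (i |: P) + (lambda + #|P|%:R) * sweep i.+1 P.
Proof.
move=> ltP; have nPi : i \notin P by apply/negP => /ltP; rewrite ltnn.
have le_Pi : (#|P| <= i)%N by apply: below_card => //; apply: ltnW.
rewrite /half_sweep (bigID (fun s => s i == i)) /=.
rewrite (bigID (fun s => i < (s^-1)%g i)%N (fun s => _ && ~~ _)) /=.
rewrite addrCA mulrDl; congr (_ + (_ + _)).
- apply: eq_big => [s|s linkP]; last by rewrite cardsU1 nPi subSS.
  rewrite -linked_open // -!andbA; congr (_ && _); rewrite andbA.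
  by congr (_ && _); rewrite ltn_neqAle andbC eq_sym.
- rewrite /sweep mulr_sumr; apply: eq_big => [s|s /andP[/andP[linkP _] /eqP si]].
    rewrite -linked_fix // -andbA; congr (_ && _); rewrite andb_idl // => /eqP->.
    by rewrite leqnn.
  rewrite mulrA -exprS; congr (lambda ^+ _ * _).
  (* Some cycle is not dead, since [i] is fixed besides the dead vertices; this
     makes the truncated subtraction in the exponent exact. *)
  rewrite subSn // subnS prednK // subn_gt0.
  have fixA : {in [set x : 'I_n | (x < i.+1)%N] :\: P, forall x, s x = x}.
    have linkS : linked i.+1 P s by rewrite -linked_fix // linkP si eqxx.
    move=> x; rewrite !inE => /andP[nPx lt_x].
    by have := linkedP _ _ _ linkS x lt_x; rewrite (negPf nPx).
  have := card_fix_porbits fixA; rewrite cardsD card_lt_ord // (setIidPr _).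
    by rewrite subSn.
  by apply/subsetP => x /ltP; rewrite inE ltnS; apply: ltnW.
(* The factor [#|P|] is one copy of the sum for each possible preimage [p]. *)
rewrite mulr_natl -sumr_const.
rewrite (partition_big (fun s => (s^-1)%g i) (mem P)) /=; last first.
  move=> s; rewrite -!andbA -leqNgt => /and4P[linkP le_si neq_si le_sVi].
  have neq : (s^-1)%g i != i by apply: contraNneq neq_si => {1}<-; rewrite permKV.
  have /linkedP/(_ ((s^-1)%g i)) := linkP.
  rewrite ltn_neqAle neq le_sVi => /(_ isT); case: ifP => // _ eq_i.
  by rewrite -eq_i permKV eqxx in neq.
apply: eq_bigr => p Pp; have lt_p := ltP _ Pp.
rewrite (reindex_inj (mulgI (tperm i p))) /=.
have neq_pi : i != p by apply: contraTneq lt_p => ->; rewrite ltnn.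
apply: eq_big => [t|t H].
  rewrite -(linked_removeR _ ltP Pp); move: (_ * t)%g => s.
  rewrite (can2_eq (permK s) (permKV s)) [p == _]eq_sym.
  case: (eqVneq ((s^-1)%g i) p) => [eq_p|_]; last by rewrite !andbF.
  rewrite eq_p -leqNgt (ltnW lt_p) !andbT [X in _ && X](_ : _ = true) ?andbT //.
  by apply: contra neq_pi => /eqP si; rewrite -eq_p -{2}si permK.
move: H; rewrite -!andbA => /and5P[linkP le_si _ _ /eqP eq_p].
have linkS : linked i.+1 P t.
  rewrite -(linked_removeR _ ltP Pp) linkP le_si /=.
  by rewrite (can2_eq (permK _) (permKV _)) eq_p.
have ti : t i = i.
  by have /linkedP/(_ i (leqnn _)) := linkS; rewrite (negPf nPi).
rewrite -(card_porbits_tperm_fix ti neq_pi) (subSn le_Pi) subSS; congr (_ * _).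
by apply: eq_bigr => j lt_ij; rewrite eq_weight_tperm // ltnW.
Qed.

Lemma sweep_end P : sweep n P = (#|P| == 0%N)%:R.
Proof.
case: (set_0Vmem P) => [->|[p Pp]]; last first.
  rewrite (cardsD1 p) Pp; apply: big_pred0 => s; apply/negP.
  by move/linkedP/(_ p (ltn_ord p)); rewrite Pp leqNgt ltn_ord.
rewrite cards0 eqxx /sweep (big_pred1 1%g) => [|s]; last first.
  apply/linkedP/eqP => [linkP|-> x _]; last by rewrite inE perm1.
  by apply/permP => x; have := linkP x (ltn_ord x); rewrite inE perm1.
rewrite big_pred0 => [|j]; last by rewrite leqNgt ltn_ord.
rewrite cards0 subn0 mulr1 (eqP (_ : (_ - n)%N == 0%N)) // subn_eq0.
by rewrite -[leqRHS]card_ord leq_imset_card.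
Qed.

(** The two half-steps are the two steps of a Dyck path between even heights. In
the sweep the weight [a h] is attached to the rise from height [2h], whereas
[dyck] attaches it to the matching descent from height [2h + 1]. The prefactor
holds the weights of the [#|P|] rises from even heights that have been read and
are matched only later. *)
Lemma sweep_dyck (alpha : nat -> R) :
  (forall h, alpha h.*2.+1 = (lambda + h%:R) * a h) ->
  (forall h, alpha h.*2.+2 = bstar b h) ->
  forall k m P, (m + k = n)%N -> below m P ->
  (\prod_(l < #|P|) a l) * sweep m P = dyck alpha #|P|.*2 k.*2.
Proof.
move=> alpha_odd alpha_even.
have prodS h : \prod_(l < h.+1) a l = (\prod_(l < h) a l) * a h.
  by rewrite big_ord_recr.
elim=> [|k IHk] m P.
  rewrite addn0 => -> _; rewrite sweep_end.
  by case: #|P| => [|h]; rewrite ?big_ord0 ?mulr1 ?mulr0.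
rewrite addnS -addSn => eq_n ltP.
have lt_mn : (m < n)%N by rewrite -eq_n leq_addr.
pose i := Ordinal lt_mn; rewrite -[m]/(val i) in eq_n ltP *.
(* The same identity between the two half-steps, at odd height. *)
have half (Q : {set 'I_n}) : below i Q ->
    (\prod_(l < #|Q|.+1) a l) * half_sweep i Q = dyck alpha #|Q|.*2.+1 k.*2.+1.
  move=> ltQ; have nQi : i \notin Q by apply/negP => /ltQ; rewrite ltnn.
  have ltQS : below i.+1 Q by move=> x /ltQ/ltnW.
  rewrite half_sweep_value // mulrDr [in X in _ + X]prodS [RHS]/= -(IHk _ _ eq_n ltQS).
  rewrite -doubleS (_ : #|Q|.+1 = #|i |: Q|) -?(IHk _ _ eq_n); last 2 first.
  - by move=> x /setU1P[->|/ltQS].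
  - by rewrite cardsU1 nQi.
  rewrite cardsU1 nQi alpha_odd; congr (_ + _).
  by rewrite [RHS]mulrC -!mulrA; congr (_ * _); rewrite mulrCA [RHS]mulrC mulrA.
rewrite sweep_index // doubleS mulrDr mulrA -prodS half //.
case def_h: #|P| => [|h] /=.
  by rewrite [X in _ + _ * X]big_pred0 ?mulr0 ?addr0 // => v; apply: (card0_eq def_h).
congr (_ + _); rewrite alpha_even; have := sum_ranks_bstar b P.
rewrite def_h => <-; rewrite mulr_suml mulr_sumr; apply: eq_bigr => v Pv.
have cardPv : #|P :\ v| = h by have := cardsD1 v P; rewrite def_h Pv => -[].
have ltPv : below i (P :\ v) by move=> x /setD1P[_ /ltP].
by rewrite mulrCA; congr (_ * _); move: (half _ ltPv); rewrite cardPv.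
Qed.
End Sweep.

Theorem theorem2p15 (R : comNzRingType) (lambda : R) (a : nat -> R)
    (b d : nat -> nat -> R)
    (hd : forall n l : nat, (1 <= n)%N -> d (n - 1)%N l = a n)
    (alpha : nat -> R)
    (halpha_odd : forall k : nat, (1 <= k)%N ->
       alpha (2 * k - 1)%N = (lambda + k%:R - 1) * a (k - 1)%N)
    (halpha_even : forall k : nat, (1 <= k)%N ->
       alpha (2 * k)%N = bstar b (k - 1)) :
  is_Sfrac alpha (fun n : nat => Qhat a b b d a lambda n).
Proof.
have dE m l : d m l = a m.+1 by rewrite -(hd m.+1 l) // subSS subn0.
have alpha_odd h : alpha h.*2.+1 = (lambda + h%:R) * a h.
  have := halpha_odd h.+1 isT.
  by rewrite mul2n doubleS !subSS !subn0 -[h.+1]addn1 natrD addrA addrK.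
have alpha_even h : alpha h.*2.+2 = bstar b h.
  by have := halpha_even h.+1 isT; rewrite mul2n doubleS subSS subn0.
apply: is_Sfrac_dyck => n; rewrite (Qhat_weight _ _ dE).
have lt0 : below 0 (set0 : {set 'I_n}) by move=> x; rewrite inE.
have := sweep_dyck alpha_odd alpha_even (add0n n) lt0.
rewrite cards0 big_ord0 mul1r => <-; apply: eq_big => [s|s _].
  by apply/esym/linkedP.
by rewrite cards0 !subn0.
Qed.
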